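(* For any integers $k\ge 2$ and $n\ge 1$, $$S(n+k,k)=S(n+k-1,k-1)+S(n+k-1,k).$$ Furthermore, the following statements hold: (i) every configuration in $puz[n+k,k,S(n+k,k)-1]$ is $k$-semi-isolated or $k$-isolated; (ii) the graph $puz[n+k,k,S(n+k,k)]$ has the even solvability property.
   Context: Let $d\ge 1$, $1\le k\le d$, $1\le l\le 2^d$ be integers. $Q^d$ is the graph of vertices and edges of the $d$-dimensional cube, with vertex set $\{0,1\}^d$. A $k$-dimensional face ($k$-face) of $Q^d$ is a set of $2^k$ vertices obtained by fixing $d-k$ of the coordinates. $\mathcal{C}[d,l]$ is the set of all configurations of $2^d-l$ tokens, labeled $1,\dots,2^d-l$, placed on distinct vertices of $Q^d$ (so $l$ vertices are unoccupied). For a configuration $C$, $\mathcal L_C=\{1,\dots,2^d-l\}$ is its set of labels (tokens). Moves: if a token $t$ sits at a vertex of a $k$-face $\sigma$ and all remaining vertices of $\sigma$ are unoccupied, then $t$ can be moved to any other vertex of $\sigma$; this is called a $k$-move. The puzzle graph $puz[d,k,l]$ has vertex set $\mathcal{C}[d,l]$, with $C$ and $D$ joined by an edge when one is reached from the other by a single $k$-move. A configuration $C$ is $k$-isolated if no token can perform a $k$-move; it is $k$-semi-isolated if there is a non-empty proper subset $\mathcal A_C\subsetneq\mathcal L_C$ such that every configuration in the connected component of $C$ in $puz[d,k,l]$ is obtained from $C$ by a series of $k$-moves affecting only tokens in $\mathcal L_C\setminus\mathcal A_C$. A configuration is obtained from $C$ by a permutation $g$ if it has the same occupied vertices and the labels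 are permuted by $g$. $puz[d,k,l]$ has the even solvability property if there is a configuration $C\in\mathcal C[d,l]$ such that all configurations obtained from $C$ by an even permutation of the labels lie in the same connected component of $puz[d,k,l]$ as $C$. $S(d,k)$ is the minimum integer $l$ such that $puz[d,k,l]$ has the even solvability property; for $d=k$ the value is taken to be $S(k,k)=2^k-1$ (the paper recalls $S(i,i)=2^i-1$ just before this theorem). *)

(* Defs.v *)
From HB Require Import structures.
From mathcomp Require Import all_boot perm.

Set Implicit Arguments.
Unset Strict Implicit.
Unset Printing Implicit Defensive.

Definition vertex (d : nat) : finType := {ffun 'I_d -> bool}.

Definition is_face (d k : nat) (sigma : {set vertex d}) : bool :=
  [exists F : {set 'I_d}, [exists v : vertex d,
    (#|F| == d - k) && (sigma == [set w : vertex d | [forall i in F, w i == v i]])]].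

(* The 2 ^ d - l tokens are labelled 0, ..., 2 ^ d - l - 1. *)
Definition token (d l : nat) : finType := 'I_(2 ^ d - l).

Definition config (d l : nat) : finType :=
  {f : {ffun token d l -> vertex d} | injectiveb f}.

Definition position (d l : nat) (C : config d l) (t : token d l) : vertex d :=
  val C t.

Definition occupied (d l : nat) (C : config d l) : {set vertex d} :=
  [set position C t | t : token d l].

Definition kmove (d l k : nat) (t : token d l) (C D : config d l) : bool :=
  [exists sigma : {set vertex d},
    [&& is_face k sigma,
        position C t \in sigma,
        [forall v in sigma :\ position C t, v \notin occupied C],
        position D t \in sigma :\ position C t &
        [forall s : token d l, (s != t) ==> (position D s == position C s)]]].

Definition puz (d l k : nat) : rel (config d l) :=
  fun C D => [exists t : token d l, kmove k t C D].

Definition puz_in (d l k : nat) (B : {set token d l}) : rel (config d l) :=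
  fun C D => [exists t in B, kmove k t C D].

Definition isolated (d l k : nat) (C : config d l) : Prop :=
  forall (t : token d l) (D : config d l), ~~ kmove k t C D.

Definition semi_isolated (d l k : nat) (C : config d l) : Prop :=
  exists A : {set token d l},
    [/\ A != set0,
        A \proper [set: token d l] &
        forall D : config d l,
          connect (puz k) C D -> connect (puz_in k (~: A)) C D].

Fact relabel_subproof (d l : nat) (C : config d l) (g : {perm token d l}) :
  injectiveb [ffun t => position C (g t)].
Proof.
apply/injectiveP => s t; rewrite !ffunE => /(injectiveP _ (valP C)).
exact: perm_inj.
Qed.

(* The vertex occupied by g t in C is occupied by t in relabel C g. *)
Definition relabel (d l : nat) (C : config d l) (g : {perm token d l}) :
  config d l := Sub [ffun t => position C (g t)] (relabel_subproof C g).

Definition even_solvable (d k l : nat) : bool :=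
  [exists C : config d l, [forall g : {perm token d l},
    ~~ odd_perm g ==> connect (puz k) C (relabel C g)]].

Lemma puz_sym (d l k : nat) : symmetric (@puz d l k).
Proof.
suff H (C D : config d l) : puz k C D -> puz k D C.
  by move=> C D; apply/idP/idP; apply: H.
case/existsP=> t /existsP[sg /and5P[Hf HC /forall_inP He]].
rewrite in_setD1 => /andP[HDC HD] /forallP Hs.
apply/existsP; exists t; apply/existsP; exists sg; apply/and5P; split=> //.
- apply/forall_inP=> v; rewrite in_setD1 => /andP[Hv Hvs].
  apply/negP=> /imsetP[s _ Es]; have [Est|Nst] := eqVneq s t.
    by rewrite Es Est eqxx in Hv.
  have Ec : position D s = position C s by apply/eqP; apply: (implyP (Hs s) Nst).
  have : v \in sg :\ position C t.
    rewrite in_setD1 Hvs andbT Es Ec; apply: contraNneq Nst => E.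
    by apply/eqP; apply: (injectiveP _ (valP C)).
  by move/He/negP; apply; rewrite Es Ec; apply: imset_f.
- by rewrite in_setD1 eq_sym HDC.
- by apply/forallP=> s; rewrite (eq_sym (position C s)); apply: Hs.
Qed.

Lemma even_solvable_ex (d k : nat) :
  exists l : nat, (1 <= l <= 2 ^ d) && even_solvable d k l.
Proof.
exists (2 ^ d); rewrite expn_gt0 leqnn /=.
have e (t : token d (2 ^ d)) : False by case: t => m; rewrite subnn.
have injf : injectiveb [ffun t : token d (2 ^ d) => False_rect (vertex d) (e t)].
  by apply/injectiveP => t; case: (e t).
apply/existsP; exists (Sub [ffun t => False_rect (vertex d) (e t)] injf : config d (2 ^ d)); apply/forallP => g; apply/implyP => _.
apply: eq_connect0; apply: val_inj; apply/ffunP => t; case: (e t).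
Qed.

(* S(d,k).  For d = k the value 2 ^ k - 1 is a convention: the graph with two
   tokens has no nontrivial even permutation, so the minimum itself would be
   2 ^ k - 2 when k >= 2. *)
Definition solv_min (d k : nat) : nat :=
  if d == k then 2 ^ k - 1 else ex_minn (even_solvable_ex d k).

(* Main.v *)
Require Import Defs.
From HB Require Import structures.
From mathcomp Require Import all_boot perm.
From mathcomp Require Import fingroup zify.

(* For 1 <= k <= d the number S(d,k) is the number of subsets of a d-set of size
   less than k, and the recursion is Pascal's rule.

   Lower bound: the polynomials over F_2 of degree less than k sum to zero over
   every k-face. With fewer empty vertices than monomials, a nonzero such
   polynomial vanishes on all empty vertices; this persists under k-moves, so
   the tokens at its nonzeros never move.

   Upper bound: identify vertices with subsets of the coordinates and leave
   exactly the sets of size less than k empty. For every set U of size greater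
   than k and i, j in U, some sequence of moves rotates the tokens at U, U - i
   and U - j and leaves the others in place. These 3-cycles generate the
   alternating group. *)

Set Implicit Arguments.
Unset Strict Implicit.
Unset Printing Implicit Defensive.

(** * Generating even permutations *)

Ltac tperm_eval :=
  repeat match goal with
  | |- context [@fun_of_perm _ (tperm ?a ?b) ?a] => rewrite (tpermL a b)
  | |- context [@fun_of_perm _ (tperm ?a ?b) ?b] => rewrite (tpermR a b)
  | |- context [@fun_of_perm _ (tperm ?a ?b) ?z] => is_var z;
      rewrite (@tpermD _ a b z); [|by []|by []]
  end.

(** Both products are the cycle [x -> y -> z -> x], written from different base points. *)
Lemma tperm_cycle3_rot (T : finType) (x y z : T) : x != y -> x != z -> y != z ->
  (tperm x y * tperm x z = tperm y z * tperm y x)%g.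
Proof.
move=> xy xz yz; have [yx zx zy] : [/\ y != x, z != x & z != y] by rewrite !(eq_sym z) eq_sym.
apply/permP => t; rewrite !permM.
have [<-|xt] := eqVneq x t; first by tperm_eval.
have [<-|yt] := eqVneq y t; first by tperm_eval.
have [<-|zt] := eqVneq z t; first by tperm_eval.
by tperm_eval.
Qed.

(** Let [p] be the cycle [x -> y -> z -> x] and [q] the cycle [x -> u -> v -> x]. The conjugate
    [p ^ q] is the cycle [u -> y -> z -> u]; its inverse followed by [p] fixes [z] and is the cycle
    [x -> y -> u -> x]. *)
Lemma cycle3_share_vertex (T : finType) (G : {group {perm T}}) (x y z u v : T) :
  uniq [:: x; y; z; u; v] ->
  (tperm x y * tperm x z)%g \in G -> (tperm x u * tperm x v)%g \in G ->
  (tperm x y * tperm x u)%g \in G.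
Proof.
move=> U; have := U; rewrite -rev_uniq /= !inE !negb_or -!andbA.
case/and5P=> vu vz vy vx /and5P[uz uy ux zy /and3P[zx yx _]].
move: U; rewrite /= !inE !negb_or -!andbA.
case/and5P=> xy xz xu xv /and5P[yz yu yv zu /and3P[zv uv _]].
set p := (_ * _)%g => Gp; set q := (_ * _)%g => Gq.
have -> : (tperm x y * tperm x u = (p ^ q)^-1 * p)%g.
  rewrite /p conjMg !tpermJ /q !permM; tperm_eval.
  rewrite invMg !tpermV; apply/permP => t; rewrite !permM.
  have [<-|xt] := eqVneq x t; first by tperm_eval.
  have [<-|yt] := eqVneq y t; first by tperm_eval.
  have [<-|zt] := eqVneq z t; first by tperm_eval.
  have [<-|ut] := eqVneq u t; first by tperm_eval.
  by tperm_eval.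
by rewrite groupM // groupV groupJ.
Qed.

(** Two transpositions in the same right coset of [G] have their product in [G], since a
    transposition is its own inverse. An even permutation splits into such pairs. *)
Lemma even_perm_in_group (T : finType) (G : {group {perm T}}) (e : {perm T}) :
  (forall x y : T, x != y -> tperm x y \in (G :* e)%g) ->
  forall g : {perm T}, ~~ odd_perm g -> g \in G.
Proof.
move=> Ge g; have [ts -> ts_ok] := prod_tpermP g; rewrite odd_perm_prod //.
have [n] := ubnP (size ts); elim: n ts ts_ok => // n IHn s.
case: s => [|[a b] [|[c d] s]] //=; first by rewrite big_nil group1.
case/and3P=> /= ab cd s_ok ln; rewrite negbK => ev.
rewrite !big_cons mulgA groupM ?IHn //; last by move: ln; rewrite /= !ltnS; apply: ltnW.
case/rcosetP: (Ge _ _ ab) => p Gp ->; case/rcosetP: (Ge _ _ cd) => q Gq Eq.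
by rewrite -(tpermV c d) Eq invMg mulgA mulgK groupM // groupV.
Qed.

(** Applied to a 3-cycle of [G] written as two transpositions, this carries coset membership from
    the first to the second. *)
Lemma tperm_coset_step (T : finType) (G : {group {perm T}}) (e : {perm T}) (a b c d : T) :
  tperm a b \in (G :* e)%g -> (tperm a b * tperm c d)%g \in G ->
  tperm c d \in (G :* e)%g.
Proof.
rewrite !mem_rcoset => Gab Gabcd.
have -> : (tperm c d * e^-1 = (tperm a b * tperm c d)^-1 * (tperm a b * e^-1))%g.
  by rewrite invMg !tpermV -!mulgA (mulgA _ _ e^-1%g) tperm2 mul1g.
by rewrite groupM // groupV.
Qed.

Lemma tperm_coset_trans (T : finType) (G : {group {perm T}}) (e : {perm T}) (x y z : T) :
  x != z -> tperm x y \in (G :* e)%g -> tperm y z \in (G :* e)%g ->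
  tperm x z \in (G :* e)%g.
Proof.
have [->//|xy] := eqVneq x y; have [-> //|yz] := eqVneq y z => xz.
move=> Gxy Gyz; apply: (tperm_coset_step Gyz).
have -> : (tperm y z * tperm x z = tperm y x * tperm y z)%g.
  have [yx zx zy] : [/\ y != x, z != x & z != y] by rewrite !(eq_sym z) eq_sym.
  by rewrite (tperm_cycle3_rot yx) // (tperm_cycle3_rot xz) // !(tpermC z).
move: Gxy Gyz; rewrite !mem_rcoset (tpermC y x) => Gxy Gyz.
suff -> : (tperm x y * tperm y z = (tperm x y * e^-1) * (tperm y z * e^-1)^-1)%g.
  by rewrite groupM // groupV.
by rewrite invMg invgK tpermV mulgA mulgKV.
Qed.

(** * Vertices as sets of coordinates, and the number of small sets *)

Definition supp (d : nat) (v : vertex d) : {set 'I_d} := [set i | v i].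

Definition vtx (d : nat) (S : {set 'I_d}) : vertex d := [ffun i => i \in S].

Lemma vtxK (d : nat) : cancel (@vtx d) (@supp d).
Proof. by move=> S; apply/setP => i; rewrite inE ffunE. Qed.

Lemma suppK (d : nat) : cancel (@supp d) (@vtx d).
Proof. by move=> v; apply/ffunP => i; rewrite ffunE inE. Qed.

Definition count_small (d k : nat) : nat := \sum_(j < k) 'C(d, j).

Lemma card_small_sets (d k : nat) :
  #|[set S : {set 'I_d} | #|S| < k]| = count_small d k.
Proof.
rewrite /count_small; elim: k => [|k IHk].
  by rewrite big_ord0; apply/eqP; rewrite cards_eq0; apply/eqP/setP => S; rewrite !inE ltn0.
rewrite big_ord_recr /= -IHk -[in 'C(_, _)](card_ord d) -card_draws.
rewrite -cardsUI [X in _ + X](_ : _ = 0) ?addn0.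
  by apply: eq_card => S; rewrite !inE ltnS leq_eqVlt orbC.
by apply/eqP; rewrite cards_eq0; apply/eqP/setP => S; rewrite !inE; apply/andP => -[lt_k /eqP eq_k]; rewrite eq_k ltnn in lt_k.
Qed.

Lemma count_smallSS (d k : nat) :
  count_small d.+1 k.+1 = count_small d k + count_small d k.+1.
Proof.
rewrite /count_small big_ord_recl [X in _ = _ + X]big_ord_recl /= addnCA -big_split /=.
by rewrite !bin0; congr (_ + _); apply: eq_bigr => i _; rewrite binS addnC.
Qed.

Lemma count_small_diag (k : nat) : count_small k k = 2 ^ k - 1.
Proof.
rewrite -[2]/(1 + 1) expnDn big_ord_recr /= binn !exp1n addnK.
by apply: eq_bigr => i _; rewrite !exp1n !muln1.
Qed.

Lemma count_small_gt0 (d k : nat) : 0 < k -> 0 < count_small d k.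
Proof. by case: k => // k _; rewrite /count_small big_ord_recl bin0. Qed.

(** There are [d + 1], hence at least three, sets of size [d - 1] or [d]. So at least three tokens
    remain, enough for a nontrivial even permutation. *)
Lemma count_small_tokens (d k : nat) : 0 < k -> k < d -> count_small d k + 3 <= 2 ^ d.
Proof.
move=> k0 kd; have -> : 2 ^ d = count_small d d.+1.
  by rewrite -[2]/(1 + 1) expnDn; apply: eq_bigr => i _; rewrite !exp1n !muln1.
have -> : count_small d d.+1 = count_small d d.-1 + d + 1.
  by case: d kd => // d _; rewrite /count_small !big_ord_recr /= binn binSn.
have : count_small d k <= count_small d d.-1.
  have -> : d.-1 = k + (d.-1 - k) by lia.
  by rewrite /count_small big_split_ord leq_addr.
by lia.
Qed.

(** * Polynomials over the two-element field *)

(* [c] lists the monomials of a multilinear polynomial over F_2, and [bpoly c v]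
   is its value at [v]. *)
Definition bpoly (d : nat) (c : {set {set 'I_d}}) (v : vertex d) : bool :=
  \big[addb/false]_(S : {set 'I_d} | S \subset supp v) (S \in c).

Lemma bpoly_add (d : nat) (a b : {set {set 'I_d}}) (v : vertex d) :
  bpoly [set S | (S \in a) (+) (S \in b)] v = bpoly a v (+) bpoly b v.
Proof. by rewrite /bpoly -big_split; apply: eq_bigr => S _; rewrite inE. Qed.

Definition flip (d : nat) (i : 'I_d) (v : vertex d) : vertex d :=
  [ffun j => if j == i then ~~ v j else v j].

Lemma flipK (d : nat) (i : 'I_d) : involutive (@flip d i).
Proof. by move=> v; apply/ffunP => j; rewrite !ffunE; case: eqP; rewrite ?negbK. Qed.

(* A monomial of degree below [k] misses one of the [k] free coordinates of the
   face, so it takes equal values at pairs of vertices of the face. *)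
Lemma bpoly_face_sum (d k : nat) (c : {set {set 'I_d}}) (sigma : {set vertex d}) :
  k <= d -> is_face k sigma -> c \subset [set S : {set 'I_d} | #|S| < k] ->
  \big[addb/false]_(w in sigma) bpoly c w = false.
Proof.
move=> kd /existsP[F /existsP[v /andP[/eqP cF /eqP ->]]] /subsetP small.
rewrite /bpoly (exchange_big_dep xpredT) //= big1 // => S _.
have [/small|_] := boolP (S \in c); last by rewrite big1.
rewrite inE => cS.
have /subsetPn[i iF iS] : ~~ (~: F \subset S).
  by apply: contraL cS => /subset_leq_card; have := cardsC F; rewrite card_ord; lia.
rewrite (bigID (fun w : vertex d => w i)) /=.
rewrite [X in X (+) _](reindex_inj (inv_inj (flipK i))) /=.
rewrite (_ : \big[_/_]_(_ | _) _ = \big[addb/false]_(w | (w \in [set w : vertex d | [forall j in F, w j == v j]]) && (S \subset supp w) && ~~ w i) true) ?addbb //.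
apply: eq_bigl => w; rewrite ffunE eqxx; congr (_ && _ && _).
  rewrite !inE; apply: eq_forallb => j; rewrite ffunE.
  have [->|//] := eqVneq j i; by rewrite (negbTE (_ : i \notin F)) // -in_setC.
apply/subsetP/subsetP => H j jS; have := H j jS; rewrite !inE ffunE.
  by case: eqP jS => // ->; rewrite (negbTE iS).
by case: eqP jS => // ->; rewrite (negbTE iS).
Qed.

(** At the vertex of a minimal monomial every other monomial vanishes. Hence a nonzero polynomial is
    a nonzero function. *)
Lemma bpoly_minset (d : nat) (c : {set {set 'I_d}}) (S : {set 'I_d}) :
  minset [pred X | X \in c] S -> bpoly c (vtx S).
Proof.
case/minsetP=> /= Sc minS; rewrite /bpoly (bigD1 S) vtxK //= Sc big1 // => X /andP[XS XnS].
by apply: contraNF XnS => Xc; rewrite (minS X).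
Qed.

(** Pigeonhole: there are [2 ^ count_small d k] polynomials of degree below [k], more than the
    subsets of [E], so two of them agree on [E]. Their sum vanishes there and is nonzero. *)
Lemma bpoly_vanishing (d k : nat) (E : {set vertex d}) : #|E| < count_small d k ->
  exists c : {set {set 'I_d}}, [/\ c \subset [set S : {set 'I_d} | #|S| < k],
    (forall v, v \in E -> bpoly c v = false) & exists v, bpoly c v].
Proof.
move=> small; pose K := [set S : {set 'I_d} | #|S| < k].
pose r (c : {set {set 'I_d}}) := [set v in E | bpoly c v].
have /dinjectivePn[a aK [b /andP[/= ba bK] rab]] : ~~ dinjectiveb r (powerset K).
  apply/negP=> /dinjectiveP/card_in_imset; rewrite card_powerset card_small_sets => cardr.
  suff : #|r @: powerset K| <= #|powerset E| by rewrite cardr card_powerset leq_exp2l // leqNgt small.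
  apply/subset_leq_card/subsetP => _ /imsetP[c _ ->]; rewrite inE.
  by apply/subsetP => v; rewrite inE => /andP[].
exists [set S | (S \in a) (+) (S \in b)]; split.
- apply/subsetP => S; rewrite inE; move: aK bK; rewrite !inE => /subsetP aK /subsetP bK.
  have [/aK|_] := boolP (S \in a); first by rewrite inE.
  by move=> /= /bK; rewrite inE.
- move=> v vE; have /setP/(_ v) := rab; rewrite !inE vE /= bpoly_add => ->.
  by rewrite addbb.
have [S Sab] : exists S, S \in [set S | (S \in a) (+) (S \in b)].
  apply/set0Pn; apply: contra ba => /eqP ab0; apply/eqP/setP => S.
  by have /setP/(_ S) := ab0; rewrite !inE; case: (S \in a); case: (S \in b).
have [S0 /bpoly_minset Sb _] := minset_exists (P := [pred X | X \in [set S | (S \in a) (+) (S \in b)]]) Sab.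
by exists (vtx S0).
Qed.

(** * Tokens that never move, and the lower bound *)

Definition frozen (d l : nat) (c : {set {set 'I_d}}) (C : config d l) : {set token d l} :=
  [set t | bpoly c (position C t)].

(** All vertices of the face except that of [t] are empty, hence zeros of the polynomial; the zero
    sum over the face makes the vertex of [t] a zero too. So [t] is not frozen, and the vertex it
    vacates is again a zero. *)
Lemma kmove_bpoly (d l k : nat) (c : {set {set 'I_d}}) (t : token d l) (C D : config d l) :
  k <= d -> c \subset [set S : {set 'I_d} | #|S| < k] ->
  (forall v, v \notin occupied C -> bpoly c v = false) -> kmove k t C D ->
  t \notin frozen c C /\
  ((forall v, v \notin occupied D -> bpoly c v = false) /\ frozen c D = frozen c C).
Proof.
move=> kd small Cc /existsP[sg /and5P[face Csg /forall_inP empty Dsg /forallP same]].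
have sg0 v : v \in sg -> bpoly c v = false.
  have [->|vC] := eqVneq v (position C t); last first.
    by move=> vsg; apply/Cc/empty; rewrite in_setD1 vC.
  have := bpoly_face_sum kd face small; rewrite (bigD1 _ Csg) big1 /= ?addbF // => w /andP[wsg wC].
  by apply/Cc/empty; rewrite in_setD1 wC.
have sameE s : s != t -> position D s = position C s.
  by move=> st; apply/eqP/(implyP (same s)).
have tC : bpoly c (position C t) = false by exact: sg0.
have tD : bpoly c (position D t) = false by apply: sg0; case/setD1P: Dsg.
split; first by rewrite inE tC.
split=> [v vD|]; last first.
  by apply/setP => s; rewrite !inE; have [->|/sameE->//] := eqVneq s t; rewrite tC tD.
have [/imsetP[s _ Es]|/Cc//] := boolP (v \in occupied C).
have [st|/sameE Ds] := eqVneq s t; first by rewrite Es st.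
by case/negP: vD; rewrite Es -Ds; apply: imset_f.
Qed.

Lemma frozen_spec (d l k : nat) (C : config d l) : k <= d -> l < count_small d k -> l <= 2 ^ d ->
  exists2 A : {set token d l}, A != set0 &
    (forall t D, kmove k t C D -> t \notin A) /\
    forall D, connect (puz k) C D ->
      connect (puz_in k (~: A)) C D /\ (forall t, t \in A -> position D t = position C t).
Proof.
move=> kd lk l2.
have cardE : #|~: occupied C| = l.
  have := cardsC (occupied C); rewrite card_ffun card_bool card_ord.
  rewrite card_imset ?card_ord; last exact: (injectiveP _ (valP C)).
  by lia.
have [c [small cE [v cv]]] : exists c : {set {set 'I_d}}, [/\ c \subset [set S : {set 'I_d} | #|S| < k],
    (forall v, v \in ~: occupied C -> bpoly c v = false) & exists v, bpoly c v].
  by apply: bpoly_vanishing; rewrite cardE.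
have Cc w : w \notin occupied C -> bpoly c w = false by rewrite -in_setC; apply: cE.
exists (frozen c C).
  have /imsetP[t _ Ev] : v \in occupied C by apply: contraTT cv => /Cc->.
  by apply/set0Pn; exists t; rewrite inE -Ev.
split=> [t D /(kmove_bpoly kd small Cc)[]//|D /connectP[p]].
have [A EA] : exists A, frozen c C = A by exists (frozen c C).
rewrite EA; move: C Cc EA {cardE cE}.
elim: p => [|C' p IHp] C Cc EA /=; first by move=> _ ->; split.
case/andP=> /existsP[t tCC'] pth lst.
have [tA [C'c EA']] := kmove_bpoly kd small Cc tCC'.
have [conD posD] := IHp C' C'c (etrans EA' EA) pth lst.
split=> [|s sA].
  apply: connect_trans conD; apply: connect1; apply/existsP; exists t.
  by rewrite tCC' inE -EA tA.
rewrite posD //; case/existsP: tCC' => sg /and5P[_ _ _ _ /forallP/(_ s)/implyP same].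
by apply/eqP/same; apply: contraNneq tA => <-; rewrite EA.
Qed.

Lemma semi_isolated_or_isolated (d l k : nat) (C : config d l) :
  k <= d -> l < count_small d k -> l <= 2 ^ d -> semi_isolated k C \/ isolated k C.
Proof.
move=> kd lk l2; have [A A0 [mvA conA]] := frozen_spec C kd lk l2.
have [AT|AT] := eqVneq A setT.
  by right=> t D; apply/negP => /mvA; rewrite AT inE.
by left; exists A; split=> // [|D /conA[]//]; rewrite properT.
Qed.

(** With three tokens, a 3-cycle through a frozen token is an even permutation that displaces it. *)
Lemma even_solvable_lower (d l k : nat) :
  k <= d -> l < count_small d k -> l + 3 <= 2 ^ d -> ~~ even_solvable d k l.
Proof.
move=> kd lk l3; apply/negP => /existsP[C /forallP evC].
have [|A /set0Pn[a aA] [_ conA]] := frozen_spec C kd lk; first by lia.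
have /card_gt1P[b [c [bC cC bc]]] : 1 < #|[set~ a]| by rewrite cardsC1 card_ord; lia.
rewrite !inE in bC cC.
have ev : ~~ odd_perm (tperm a b * tperm a c)%g.
  by rewrite odd_permM !odd_tperm !(eq_sym a) bC cC.
have /conA[_ /(_ _ aA)] := implyP (evC _) ev.
rewrite /position /= ffunE => /(injectiveP _ (valP C)).
by rewrite permM tpermL tpermD // 1?eq_sym // => /eqP; rewrite (negbTE bC).
Qed.

(** * Reachable configurations *)

Definition pos (d l : nat) (C : config d l) (t : token d l) : {set 'I_d} :=
  supp (position C t).

Lemma pos_inj (d l : nat) (C : config d l) : injective (pos C).
Proof. by move=> s t /(can_inj (@suppK d))/(injectiveP _ (valP C)). Qed.

Lemma config_pos_inj (d l : nat) (C D : config d l) : pos C =1 pos D -> C = D.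
Proof.
by move=> CD; apply/val_inj/ffunP => t; apply/(can_inj (@suppK d))/CD.
Qed.

Lemma pos_relabel (d l : nat) (C : config d l) (g : {perm token d l}) (t : token d l) :
  pos (relabel C g) t = pos C (g t).
Proof. by rewrite /pos /position /= ffunE. Qed.

Lemma vtx_comp_injective (d l : nat) (h : token d l -> {set 'I_d}) :
  injective h -> injectiveb [ffun t => vtx (h t)].
Proof.
by move=> hI; apply/injectiveP => s t; rewrite !ffunE => /(can_inj (@vtxK d))/hI.
Qed.

Definition mk_config (d l : nat) (h : token d l -> {set 'I_d}) (hI : injective h) : config d l :=
  Sub [ffun t => vtx (h t)] (vtx_comp_injective hI).

Lemma pos_mk_config (d l : nat) (h : token d l -> {set 'I_d}) (hI : injective h) :
  pos (mk_config hI) =1 h.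
Proof. by move=> t; rewrite /pos /position /= ffunE vtxK. Qed.

Definition between (d : nat) (T U X : {set 'I_d}) : bool := (T \subset X) && (X \subset U).

Lemma is_face_between (d k : nat) (T U : {set 'I_d}) : T \subset U -> #|U :\: T| = k ->
  is_face k [set w : vertex d | between T U (supp w)].
Proof.
(* The fixed coordinates are those outside [U :\: T]; [vtx T] gives them the value true in [T] and
   false outside [U]. *)
move=> TU cardUT; apply/existsP; exists (~: (U :\: T)); apply/existsP; exists (vtx T).
have -> : #|~: (U :\: T)| == d - k.
  by have := cardsC (U :\: T); rewrite card_ord cardUT => cardE; apply/eqP; lia.
apply/eqP/setP => w; rewrite !inE.
apply/andP/forall_inP => [[/subsetP Tw /subsetP wU] i|H].
  rewrite !inE negb_and negbK ffunE.
  have [/Tw|iT /= iU] := boolP (i \in T); first by rewrite inE => ->.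
  by apply: contraNT iU => wi; apply: wU; rewrite inE; case: (w i) wi.
split; apply/subsetP => i; have := H i; rewrite !inE ffunE negb_and negbK.
  by move=> /[swap] iT; rewrite iT => /(_ isT)/eqP.
move=> /[swap] wi; rewrite wi; case: (boolP (i \in U)) => //= iU /(_ (orbT _))/eqP/esym iT.
by rewrite (subsetP TU) in iU.
Qed.

(* No face meets the old or new position of another token, so the tokens may
   move one at a time in any order. *)
Lemma batch_move (d l k : nat) (C : config d l) (h : token d l -> {set 'I_d}) :
  (forall t, h t != pos C t -> exists T U : {set 'I_d}, [/\ T \subset U, #|U :\: T| = k,
     between T U (pos C t) && between T U (h t) &
     forall s, s != t -> ~~ between T U (pos C s) && ~~ between T U (h s)]) ->
  exists2 D : config d l, connect (puz k) C D & pos D =1 h.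
Proof.
have [n] := ubnP #|[pred t | h t != pos C t]|; elim: n C => // n IHn C leCn face.
have [/eqP fix0|/pred0Pn[t /= ht]] := boolP (#|[pred t | h t != pos C t]| == 0).
  by exists C => // t; have /card0_eq/(_ t) := fix0; rewrite inE => /negbFE/eqP.
have [T [U [TU UT /andP[Ct Ht] others]]] := face t ht.
pose h' s := if s == t then h t else pos C s.
have h'I : injective h'.
  move=> r s; rewrite /h'; case: eqP => [->|/eqP rt]; case: eqP => [->|/eqP st] //; last exact: pos_inj.
    by move=> E; have /andP[/negP[]] := others s st; rewrite -E.
  by move=> E; have /andP[/negP[]] := others r rt; rewrite E.
pose C' := mk_config h'I; have posC' : pos C' =1 h' by exact: pos_mk_config.
have [||D C'D Dh] := IHn C'.
- rewrite (leq_trans _ (leCn : _ <= n)) //; apply/proper_card/properP; split.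
    by apply/subsetP => s; rewrite !inE posC' /h'; have [->|//] := eqVneq s t; rewrite eqxx.
  by exists t; rewrite !inE ?posC' /h' ?eqxx.
- move=> s; rewrite posC' /h'; have [->|st hs] := eqVneq s t; first by rewrite eqxx.
  (* The faces chosen at the start still serve: each other token [r] is now at its old or its new
     position, and both are excluded. *)
  have [T' [U' [T'U' U'T' CHs others']]] := face s hs.
  exists T', U'; split=> // r rs; rewrite posC' /h'.
  by have := others' r rs; case: eqP => // ->; case/andP=> _ ->.
exists D => //; apply: connect_trans C'D; apply: connect1; apply/existsP; exists t.
have posE s : position C' s = if s == t then vtx (h t) else position C s.
  by apply: (can_inj (@suppK d)); rewrite -/(pos C' s) posC' /h'; case: eqP => // _; rewrite vtxK.
apply/existsP; exists [set w : vertex d | between T U (supp w)]; apply/and5P; split.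
- exact: is_face_between.
- by rewrite inE.
- apply/forall_inP => v /setD1P[vC]; rewrite inE => vTU; apply/negP => /imsetP[s _ Ev].
  have st : s != t by apply: contraNneq vC => <-; rewrite Ev.
  by have /andP[/negP[]] := others s st; rewrite /pos -Ev.
- rewrite posE eqxx !inE vtxK Ht andbT; apply: contraNneq ht => E.
  by rewrite /pos -E vtxK.
- by apply/forallP => s; rewrite posE; apply/implyP => /negbTE->.
Qed.

(** The only occupied positions of the interval from [T] to [U] once it has been cleared: the top
    and its lower neighbours. *)
Definition near_top (d : nat) (T U X : {set 'I_d}) : Prop :=
  X = U \/ exists2 m, m \in U :\: T & X = U :\ m.

(** One stage of a rotation: [f] and [f'] map the initial set of a token to its set before and after
    the stage. A coordinate [p] keeps the value [b] for the moving token and the opposite value for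
    all others in the face, so the token moves in a [k]-face of its own. *)
Lemma near_top_step (d l k : nat) (C D : config d l) (T U : {set 'I_d})
    (f f' : {set 'I_d} -> {set 'I_d}) :
  T \subset U -> #|U :\: T| = k.+1 ->
  (forall t, between T U (pos C t) -> near_top T U (pos C t)) ->
  connect (puz k) C D ->
  (forall t, pos D t = if between T U (pos C t) then f (pos C t) else pos C t) ->
  (forall X, near_top T U X -> f' X != f X ->
     between T U (f X) /\ between T U (f' X) /\
     exists2 p, p \in U :\: T & exists b : bool, (p \in f X) = b /\ (p \in f' X) = b /\
       forall Y, near_top T U Y -> Y != X -> (p \in f Y) = ~~ b /\ (p \in f' Y) = ~~ b) ->
  exists2 D' : config d l, connect (puz k) C D' &
    forall t, pos D' t = if between T U (pos C t) then f' (pos C t) else pos C t.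
Proof.
move=> TU cardUT near CD Dpos step.
suff [D' DD' D'pos] : exists2 D', connect (puz k) D D' &
    pos D' =1 fun t => if between T U (pos C t) then f' (pos C t) else pos C t.
  by exists D' => //; apply: connect_trans DD'.
apply: batch_move => t; rewrite Dpos; case: ifP => [inC move_t|_]; last by rewrite eqxx.
have [inf [inf' [p pUT [b [pf [pf' pY]]]]]] := step _ (near t inC) move_t.
have [pU pT] : p \in U /\ p \notin T by case/setDP: pUT.
have cardm : #|(U :\: T) :\ p| = k by apply/eqP; rewrite -eqSS -cardUT (cardsD1 p (U :\: T)) pUT.
pose T' := if b then p |: T else T; pose U' := if b then U else U :\ p.
have betE X : between T' U' X = between T U X && ((p \in X) == b).
  rewrite /between /T' /U'; case: b {pf pf' pY T' U'}.
    by rewrite subUset sub1set eqb_id; case: (p \in X); rewrite ?andbT ?andbF.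
  by rewrite subsetD1 eqbF_neg andbA.
exists T', U'; split.
- rewrite /T' /U'; case: b {pf pf' pY T' U' betE}; last by rewrite subsetD1 TU.
  by rewrite subUset sub1set pU.
- rewrite -cardm; congr #|pred_of_set _|; apply/setP => x; rewrite /T' /U'.
  by case: b {pf pf' pY T' U' betE}; rewrite !inE ?negb_or; case: (x == p); rewrite ?andbF.
- by rewrite !betE inf inf' pf pf' eqxx.
- move=> s st; rewrite Dpos; case: ifP => [inY|outY]; last by rewrite betE outY.
  have YX : pos C s != pos C t by apply: contraNneq st => /pos_inj ->.
  have [pfY pfY'] := pY _ (near s inY) YX.
  by rewrite !betE pfY pfY'; case: (b); rewrite !andbF.
Qed.

(* With A, B, C the tokens at [U], [U :\ i], [U :\ j]: drop all the
   [U :\ m], [m != j], by [j]; A takes the place of B; drop the remaining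
   [U :\ m] by [i] instead of [j]; C takes the place of A; restore the
   [U :\ m]; B takes the place of C. *)
Lemma cycle3_face (d l k : nat) (C : config d l) (T U : {set 'I_d}) (i j : 'I_d) :
  T \subset U -> #|U :\: T| = k.+1 -> i \in U :\: T -> j \in U :\: T -> i != j ->
  (forall t, between T U (pos C t) -> near_top T U (pos C t)) ->
  exists2 D : config d l, connect (puz k) C D &
    forall t, pos D t = if pos C t == U then U :\ i else if pos C t == U :\ i then U :\ j
                        else if pos C t == U :\ j then U else pos C t.
Proof.
move=> TU cardUT iUT jUT ij near.
have ji : j != i by rewrite eq_sym.
have U_m m : m \in U :\: T -> (U :\ m == U) = false.
  by case/setDP=> mU _; apply/eqP => /setP/(_ m); rewrite !inE eqxx mU.
have U_mn m n : m \in U :\: T -> (U :\ m == U :\ n) = (m == n).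
  case/setDP=> mU _; apply/eqP/eqP => [/setP/(_ m)|->//].
  by rewrite !inE eqxx mU andbT /=; case: (m =P n).
have b0 : between T U U by rewrite /between TU subxx.
have b1 m : m \in U :\: T -> between T U (U :\ m).
  by case/setDP=> _ mT; rewrite /between subsetD1 TU mT subD1set.
have b2 m n : m \in U :\: T -> n \in U :\: T -> between T U (U :\ m :\ n).
  move=> /b1/andP[Tm mU] /setDP[_ nT].
  by rewrite /between subsetD1 Tm nT (subset_trans _ mU) // subD1set.
have [iU jU] : i \in U /\ j \in U by case/setDP: iUT; case/setDP: jUT.
have inU m : m \in U :\: T -> m \in U by case/setDP.
(* [f1] to [f6] give the positions after the six stages. In stages 1, 3 and 5 the token started at
   [U :\ m] is separated by the absence of [m]; in stages 2, 4 and 6 a single token moves, separated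
   by the presence of [j], the presence of [i] and the absence of [j]. *)
pose f1 X := if X == U then U else X :\ j.
pose f2 X := if X == U then U :\ i else X :\ j.
pose f3 X := if X == U then U :\ i else if X == U :\ j then X else
             if X == U :\ i then X :\ j else X :\ i.
pose f4 X := if X == U then U :\ i else if X == U :\ j then U else
             if X == U :\ i then X :\ j else X :\ i.
pose f5 X := if X == U then U :\ i else if X == U :\ j then U else
             if X == U :\ i then X :\ j else X.
pose f6 X := if X == U then U :\ i else if X == U :\ j then U else
             if X == U :\ i then U :\ j else X.
have Uii m : U :\ m :\ m = U :\ m by apply/setP => x; rewrite !inE; case: eqP.
have [||D1 CD1 D1pos] := near_top_step (f := id) (f' := f1) TU cardUT near (connect0 _ C).
- by move=> t; case: ifP.
- move=> X [->|[m mUT ->]]; first by rewrite /f1 eqxx eqxx.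
  rewrite /f1 U_m //; have [->|mj _] := eqVneq m j; first by rewrite Uii eqxx.
  split; first exact: b1. split; first exact: b2.
  exists m => //; exists false; rewrite !inE eqxx andbF; do 2!split=> //.
  move=> Y [->|[n nUT ->]]; first by rewrite eqxx inU.
  by rewrite U_m // U_mn // !inE (eq_sym n) => ->; rewrite mj inU.
have [|D2 CD2 D2pos] := near_top_step (f' := f2) TU cardUT near CD1 D1pos.
- move=> X [->|[m mUT ->]]; rewrite /f1 /f2 ?eqxx ?U_m ?eqxx // => _.
  split=> //; split; first exact: b1.
  exists j => //; exists true; rewrite !inE ji jU; do 2!split=> //.
  move=> Y [->|[n nUT ->]]; first by rewrite eqxx.
  by rewrite U_m // !inE eqxx.
have [|D3 CD3 D3pos] := near_top_step (f' := f3) TU cardUT near CD2 D2pos.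
- move=> X [->|[m mUT ->]]; rewrite /f2 /f3 ?eqxx // U_m // !U_mn //.
  have [->|mj] := eqVneq m j; first by rewrite Uii eqxx.
  have [->|mi _] := eqVneq m i; first by rewrite eqxx.
  split; first exact: b2. split; first exact: b2.
  exists m => //; exists false; rewrite !inE eqxx !andbF; do 2!split=> //.
  move=> Y [->|[n nUT ->]]; first by rewrite !eqxx !inE mi inU.
  rewrite U_m // !U_mn // (eq_sym n m) => mn.
  by do 2?case: ifP => _; rewrite ?inE ?mn ?mi ?mj ?inU.
have [|D4 CD4 D4pos] := near_top_step (f' := f4) TU cardUT near CD3 D3pos.
- move=> X [->|[m mUT ->]]; rewrite /f3 /f4 ?eqxx // U_m // !U_mn //.
  have [->|mj] := eqVneq m j; last by rewrite eqxx.
  split; first exact: b1. split=> //.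
  exists i => //; exists true; rewrite !inE ij iU; do 2!split=> //.
  move=> Y [->|[n nUT ->]]; first by rewrite !eqxx !inE eqxx.
  rewrite U_m // !U_mn // => /negbTE ->.
  by case: ifP => [/eqP->|_]; rewrite !inE eqxx ?andbF.
have [|D5 CD5 D5pos] := near_top_step (f' := f5) TU cardUT near CD4 D4pos.
- move=> X [->|[m mUT ->]]; rewrite /f4 /f5 ?eqxx // U_m // !U_mn //.
  have [->|mj] := eqVneq m j; first by rewrite eqxx.
  have [->|mi _] := eqVneq m i; first by rewrite eqxx.
  split; first exact: b2. split; first exact: b1.
  exists m => //; exists false; rewrite !inE eqxx !andbF; do 2!split=> //.
  move=> Y [->|[n nUT ->]]; first by rewrite !eqxx !inE mi inU.
  rewrite U_m // !U_mn // (eq_sym n m) => mn.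
  by do 2?case: ifP => _; rewrite ?inE ?mn ?mi ?mj ?inU.
have [|D6 CD6 D6pos] := near_top_step (f' := f6) TU cardUT near CD5 D5pos.
- move=> X [->|[m mUT ->]]; rewrite /f5 /f6 ?eqxx // U_m // !U_mn //.
  have [->|mj] := eqVneq m j; first by rewrite eqxx.
  have [-> _|mi] := eqVneq m i; last by rewrite eqxx.
  split; first exact: b2. split; first exact: b1.
  exists j => //; exists false; rewrite !inE eqxx; do 2!split=> //.
  move=> Y [->|[n nUT ->]]; first by rewrite !eqxx !inE ji jU.
  rewrite U_m // !U_mn // => /negbTE ->.
  by case: ifP => [_|nj]; rewrite ?inE ?(eq_sym j) ?nj jU.
exists D6 => // t; rewrite D6pos /f6.
case: ifPn => [_|]; last first.
  by do 3!(case: eqP => [->|_]; first by rewrite ?b0 ?b1).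
case: eqP => // _; case: eqP => [->|_]; last by [].
by rewrite U_mn // (negbTE ji).
Qed.

(* Induction on [T]: for [x] in [T], once [T :\ x] is treated, the tokens at the
   sets [X] containing [T] with [#|X| = k + #|T :\ x|] lose [x]. *)
Lemma clear_below (d l k : nat) (C : config d l) (T : {set 'I_d}) :
  (forall t, k <= #|pos C t|) ->
  exists2 D : config d l, connect (puz k) C D & forall t,
    if (T \subset pos C t) && (k + #|T| <= #|pos C t|) then pos D t = pos C t
    else ~~ (T \subset pos D t).
Proof.
move=> Ck; have [n] := ubnP #|T|; elim: n T => // n IHn T leT.
have [->|[x xT]] := set_0Vmem T.
  by exists C => // t; rewrite sub0set cards0 addn0 Ck.
have cardT := cardsD1 x T; rewrite xT add1n in cardT.
have [|D CD Dpos] := IHn (T :\ x); first by lia.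
pose h t := if (T \subset pos D t) && (#|pos D t| == k + #|T :\ x|) then pos D t :\ x else pos D t.
have [|D' DD' D'pos] := @batch_move d l k D h.
- move=> t; rewrite /h; case: ifP => [/andP[TDt /eqP cardD]|]; last by rewrite eqxx.
  move=> _; have Tx : T :\ x \subset pos D t by apply: subset_trans TDt; apply: subD1set.
  exists (T :\ x), (pos D t); split=> //.
  + by rewrite cardsD (setIidPr Tx) cardD addnK.
  + rewrite /between Tx subxx subD1set /= andbT.
    by rewrite subsetD1 Tx !inE eqxx.
  + move=> s st.
    (* By induction a token whose set contains [T :\ x] has at least [k + #|T :\ x|] elements, the
       size of [pos D t]. So inside [pos D t] it can only be [t] itself. *)
    have neD (X : {set 'I_d}) : X \subset pos D t -> pos D s \subset X -> T :\ x \subset pos D s -> False.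
      move=> XD sX Ts; have := Dpos s.
      case: ifP => [/andP[_ cards] posE|_]; last by rewrite Ts.
      case/eqP: st; apply: (@pos_inj _ _ D); apply/eqP.
      by rewrite eqEcard (subset_trans sX XD) posE cardD.
    have c1 : ~~ between (T :\ x) (pos D t) (pos D s).
      by apply/negP => /andP[Ts sD]; apply: (neD (pos D t)).
    rewrite c1 /=; case: ifP => // /andP[Ts _].
    apply/negP => /andP[Txs sD]; have Txs' : T :\ x \subset pos D s by apply: subset_trans Ts; apply: subD1set.
    case/negP: c1; rewrite /between Txs' /=; apply/subsetP => y ys.
    have [->|yx] := eqVneq y x; first exact: (subsetP TDt _ xT).
    by apply: (subsetP sD); rewrite in_setD1 yx ys.
exists D'; first exact: connect_trans DD'.
move=> t; rewrite D'pos /h; have := Dpos t.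
have subT (X : {set 'I_d}) : T \subset X -> T :\ x \subset X by apply/subset_trans/subD1set.
case: ifP => [/andP[TxC cardC] DC|out nTD]; last first.
  rewrite ifF; last by apply/negP => /andP[/subT Ts le]; rewrite Ts in out; lia.
  case: ifP => [/andP[/subT TD _]|_]; first by rewrite TD in nTD.
  by apply: contra nTD => /subT.
rewrite DC; have [TC|nTC] /= := boolP (T \subset pos C t); last by [].
have [eqk|nek] := eqVneq #|pos C t| (k + #|T :\ x|).
  rewrite ifF; last by rewrite cardT eqk addnS ltnn.
  by apply/negP => /subsetP/(_ x xT); rewrite !inE eqxx.
by rewrite ifT //; move: cardC; rewrite cardT addnS ltn_neqAle eq_sym nek.
Qed.

(** * Rotations of three tokens *)

Lemma kmove_relabel (d l k : nat) (g : {perm token d l}) (t : token d l) (C D : config d l) :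
  kmove k t C D -> kmove k ((g^-1)%g t) (relabel C g) (relabel D g).
Proof.
have posE (B : config d l) s : position (relabel B g) s = position B (g s).
  by rewrite /position /= ffunE.
have occE : occupied (relabel C g) = occupied C.
  apply/setP => v; apply/imsetP/imsetP => -[s _ ->].
    by exists (g s); rewrite ?posE.
  by exists ((g^-1)%g s); rewrite ?posE ?permKV.
case/existsP=> sg /and5P[face Csg empty Dsg /forallP same].
apply/existsP; exists sg; rewrite !posE permKV occE face Csg empty Dsg /=.
apply/forallP => s; rewrite !posE; apply/implyP => st; apply: (implyP (same (g s))).
by apply: contraNneq st => <-; rewrite permK.
Qed.

Lemma connect_relabel (d l k : nat) (g : {perm token d l}) (C D : config d l) :
  connect (puz k) C D -> connect (puz k) (relabel C g) (relabel D g).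
Proof.
case/connectP=> p; elim: p C => [|C' p IHp] C /=; first by move=> _ ->.
case/andP=> /existsP[t /(kmove_relabel g) CC'] /IHp /[apply].
by apply: connect_trans; apply: connect1; apply/existsP; exists ((g^-1)%g t).
Qed.

Definition reachable_perms (d l k : nat) (C : config d l) : {set {perm token d l}} :=
  [set g | connect (puz k) C (relabel C g)].

(** Relabelling the path for [h] by [g] and appending it to the path for [g] gives a path for
    [g * h]. *)
Lemma reachable_perms_group_set (d l k : nat) (C : config d l) :
  group_set (reachable_perms k C).
Proof.
apply/group_setP; split=> [|g h]; rewrite !inE.
  by rewrite (_ : relabel C 1 = C) //; apply: config_pos_inj => t; rewrite pos_relabel perm1.
move=> Cg /(connect_relabel g); rewrite (_ : relabel (relabel C h) g = relabel C (g * h)%g).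
  exact: connect_trans.
by apply: config_pos_inj => t; rewrite !pos_relabel permM.
Qed.

Definition reachable_group (d l k : nat) (C : config d l) : {group {perm token d l}} :=
  group (reachable_perms_group_set k C).

(* Clear a [(k+1)]-face with top [pos C a], rotate the three tokens there, and
   undo the clearing. *)
Lemma cycle3_reachable (d l k : nat) (C : config d l) (a b c : token d l) (i j : 'I_d) :
  0 < k -> (forall t, k <= #|pos C t|) -> i \in pos C a -> j \in pos C a -> i != j ->
  k < #|pos C a| -> pos C b = pos C a :\ i -> pos C c = pos C a :\ j ->
  (tperm a b * tperm a c)%g \in reachable_group k C.
Proof.
move=> k0 Ck; set U := pos C a => iU jU ij kU Cb Cc.
have ji : j != i by rewrite eq_sym.
have [T /andP[TU /eqP cardT]] : exists T : {set 'I_d}, (T \subset U :\ i :\ j) && (#|T| == #|U| - k.+1).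
  pose A := U :\ i :\ j.
  have cardA : #|U| = #|A|.+2.
    by rewrite (cardsD1 i U) iU (cardsD1 j (U :\ i)) in_setD1 ji jU.
  exists [set x in take (#|U| - k.+1) (enum A)]; apply/andP; split.
    by apply/subsetP => x; rewrite inE => /mem_take; rewrite mem_enum.
  rewrite cardsE (card_uniqP _) ?take_uniq ?enum_uniq // size_takel // -cardE; lia.
move: TU; rewrite !subsetD1 => /andP[/andP[TU iT] jT].
have cardUT : #|U :\: T| = k.+1 by rewrite cardsD (setIidPr TU) cardT subKn.
(* The threshold of [clear_below] is thus [#|U| - 1]: it spares [U] and its lower neighbours and
   clears the rest of the face. *)
have cardU_m m : m \in U -> #|U :\ m| = k + #|T|.
  by move=> mU; apply/eqP; rewrite -eqSS -addSn cardT subnKC // (cardsD1 m U) mU.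
have [D CD Dpos] := clear_below T Ck.
have near t : between T U (pos D t) -> near_top T U (pos D t).
  case/andP=> TDt DtU; have := Dpos t; case: ifP => [/andP[_ cardt] DC|_]; last by rewrite TDt.
  have [->|DnU] := eqVneq (pos D t) U; first by left.
  have /properP[_ [m mU mD]] : pos D t \proper U by rewrite properEneq DnU.
  right; exists m; first by rewrite inE mU (contra _ mD) //; apply: (subsetP TDt).
  apply/eqP; rewrite eqEcard subsetD1 DtU mD /= DC.
  by rewrite cardU_m.
have iUT : i \in U :\: T by rewrite in_setD iT.
have jUT : j \in U :\: T by rewrite in_setD jT.
have [E DE Epos] := cycle3_face (k := k) (C := D) TU cardUT iUT jUT ij near.
have Da : pos D a = U.
  by have := Dpos a; rewrite -/U TU (leq_trans _ (subset_leq_card (subD1set U i))) ?cardU_m.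
have Db : pos D b = U :\ i.
  by have := Dpos b; rewrite Cb subsetD1 TU iT cardU_m // leqnn.
have Dc : pos D c = U :\ j.
  by have := Dpos c; rewrite Cc subsetD1 TU jT cardU_m // leqnn.
have U_m m : m \in U -> (U :\ m == U) = false.
  by move=> mU; apply/eqP => /setP/(_ m); rewrite in_setD1 eqxx mU.
have U_ij : (U :\ j == U :\ i) = false.
  by apply/eqP => /setP/(_ i); rewrite !in_setD1 eqxx ij iU.
have posD s t : (pos D s == pos D t) = (s == t) by rewrite (inj_eq (@pos_inj _ _ D)).
have ab : a != b by rewrite -posD Da Db eq_sym U_m.
have ac : a != c by rewrite -posD Da Dc eq_sym U_m.
have bc : b != c by rewrite -posD Db Dc eq_sym U_ij.
have cb : c != b by rewrite eq_sym.
rewrite inE; set g := (_ * _)%g.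
have EE : E = relabel D g.
  apply: config_pos_inj => t; rewrite Epos pos_relabel permM.
  have [<-|at_] := eqVneq a t; first by (tperm_eval; rewrite Da Db eqxx).
  have [<-|bt] := eqVneq b t; first by (tperm_eval; rewrite Db Dc U_m // eqxx).
  have [<-|ct] := eqVneq c t.
    by rewrite (tpermD ac bc) tpermR Dc U_m // U_ij eqxx.
  by tperm_eval; rewrite -Db -Dc -Da !posD !(eq_sym t) (negbTE at_) (negbTE bt) (negbTE ct).
apply: (connect_trans CD); apply: (connect_trans DE); rewrite EE (sym_connect_sym (@puz_sym d l k)).
exact: connect_relabel.
Qed.

(* The 3-cycles of [cycle3_reachable] form a connected hypergraph on the tokens. *)
Lemma tperm_coset (d l k : nat) (C : config d l) (a0 b0 : token d l) (i0 : 'I_d) :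
  0 < k -> (forall t, k <= #|pos C t|) -> (forall X : {set 'I_d}, k <= #|X| -> exists t, pos C t = X) ->
  k < d -> pos C a0 = setT -> pos C b0 = [set~ i0] ->
  forall x y, x != y -> tperm x y \in (reachable_group k C :* tperm a0 b0)%g.
Proof.
move=> k0 Ck occ kd Ca0 Cb0; set G := reachable_group k C; set e := tperm a0 b0.
(* Induction downward from the full set: every transposition of a token with a lower neighbour lies
   in the coset of the reference transposition [e]. *)
have edge a b i : i \in pos C a -> pos C b = pos C a :\ i -> tperm a b \in (G :* e)%g.
  have [n] := ubnP (d - #|pos C a|); elim: n a b i => // n IHn a b i le_n ia Cb.
  have ka : k < #|pos C a|.
    by have := Ck b; rewrite Cb (cardsD1 i (pos C a)) ia.
  have [j jb] : exists j, j \in pos C b.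
    by apply/set0Pn; rewrite -card_gt0 (leq_trans k0).
  have [ji ja] : j != i /\ j \in pos C a by move: jb; rewrite Cb => /setD1P[].
  have [aT|/existsP[m ma]] := altP (@forallP _ (fun x => x \in pos C a)).
    have aa0 : a = a0 by apply: (@pos_inj _ _ C); rewrite Ca0; apply/setP => x; rewrite aT inE.
    rewrite {}aa0 in Cb *.
    have [ii0|ii0] := eqVneq i i0.
      have -> : b = b0 by apply: (@pos_inj _ _ C); rewrite Cb Ca0 Cb0 ii0 setTD.
      exact: rcoset_refl.
    apply: (@tperm_coset_step _ _ _ a0 b0); first exact: rcoset_refl.
    by apply: (cycle3_reachable (i := i0) (j := i)) => //; rewrite ?Ca0 ?inE ?(eq_sym i0) ?Cb0 ?setTD // cardsT card_ord.
  have cardU : #|m |: pos C a| = #|pos C a|.+1 by rewrite cardsU1 ma.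
  have [a' Ca'] : exists a', pos C a' = m |: pos C a by apply: occ; rewrite cardU leqW // ltnW.
  have [c Cc] : exists c, pos C c = pos C a :\ j.
    by apply: occ; move: ka; rewrite (cardsD1 j (pos C a)) ja.
  have [c' Cc'] : exists c', pos C c' = pos C a' :\ i.
    apply: occ; have := cardsD1 i (pos C a'); rewrite Ca' cardU in_setU1 ia orbT add1n => -[<-].
    exact: ltnW.
  have mi : m != i by apply: contraNneq ma => ->.
  have Caa' : pos C a = pos C a' :\ m by rewrite Ca' setU1K.
  have ma' : m \in pos C a' by rewrite Ca' setU11.
  have ia' : i \in pos C a' by rewrite Ca' setU1r.
  have ta'a : tperm a' a \in (G :* e)%g.
    apply: (IHn a' a m) => //; rewrite Ca' cardU.
    have := max_card [in m |: pos C a]; rewrite cardU card_ord => ltd.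
    by move: le_n; rewrite ltnS; apply: leq_trans; rewrite subnS prednK // subn_gt0.
  have cyc1 : (tperm a b * tperm a c)%g \in G.
    by apply: (cycle3_reachable (i := i) (j := j)) => //; rewrite eq_sym.
  have cyc2 : (tperm a' a * tperm a' c')%g \in G.
    by apply: (cycle3_reachable (i := m) (j := i)) => //; rewrite Ca' cardU ltnW.
  have mem_neq s t x : x \in pos C s -> x \notin pos C t -> (s != t) * (t != s).
    by move=> xs xt; rewrite (eq_sym t); split; apply: contraNneq xt => <-.
  have a'a : (a' != a) * (a != a') by apply: (mem_neq _ _ m).
  have mb : m \notin pos C b by rewrite Cb in_setD1 negb_and ma orbT.
  have mc : m \notin pos C c by rewrite Cc in_setD1 negb_and ma orbT.
  have mc' : m \in pos C c' by rewrite Cc' in_setD1 mi.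
  have ic' : i \notin pos C c' by rewrite Cc' in_setD1 eqxx.
  have ib : i \notin pos C b by rewrite Cb in_setD1 eqxx.
  have ic : i \in pos C c by rewrite Cc in_setD1 eq_sym ji.
  have jc : j \notin pos C c by rewrite Cc in_setD1 eqxx.
  (* The two 3-cycles, on [a, b, c] and on [a', a, c'], meet only in [a]. They combine to a 3-cycle
     on [a, a', b], which carries membership from [a' a] to [a b]. *)
  apply: (tperm_coset_step ta'a); rewrite (tpermC a' a).
  apply: (cycle3_share_vertex (z := c') (v := c)) => //.
    rewrite /= !inE !negb_or !andbT.
    rewrite a'a (mem_neq a c' i) // (mem_neq a b i) // (mem_neq a c j) //=.
    rewrite (mem_neq a' c' i) // (mem_neq a' b i) // (mem_neq a' c m) //=.
    by rewrite (mem_neq c' b m) // (mem_neq c' c m) // (mem_neq c b i).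
  rewrite -(groupV G) invMg !tpermV -(tperm_cycle3_rot (z := c')) // ?(mem_neq a' c' i) ?(mem_neq a c' i) ?a'a //.
(* Adding elements one by one links every token to [a0], and any two tokens are then linked through
   [a0]. *)
have top x : x != a0 -> tperm x a0 \in (G :* e)%g.
  have [n] := ubnP (d - #|pos C x|); elim: n x => // n IHn x le_n xa0.
  have [m mx] : exists m, m \notin pos C x.
    apply/existsP; apply: contraNT xa0 => /existsPn xT; apply/eqP/(@pos_inj _ _ C).
    by rewrite Ca0; apply/setP => m; rewrite in_setT; have := xT m; rewrite negbK.
  have cardx : #|m |: pos C x| = #|pos C x|.+1 by rewrite cardsU1 mx.
  have [y Cy] : exists y, pos C y = m |: pos C x by apply: occ; rewrite cardx leqW.
  have yx : tperm y x \in (G :* e)%g.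
    by apply: (edge y x m); rewrite Cy ?setU11 // setU1K.
  have [ya0|ya0] := eqVneq y a0; first by rewrite tpermC -{1}ya0.
  apply: (tperm_coset_trans (y := y)) => //; first by rewrite tpermC.
  apply: IHn => //; rewrite Cy cardx.
  have := max_card [in m |: pos C x]; rewrite cardx card_ord => ltd.
  by move: le_n; rewrite ltnS; apply: leq_trans; rewrite subnS prednK // subn_gt0.
move=> x y xy; have [xa0|xa0] := eqVneq x a0.
  by rewrite xa0 tpermC; apply: top; rewrite -xa0 eq_sym.
have [->|ya0] := eqVneq y a0; first exact: top.
apply: (tperm_coset_trans xy (top x xa0)); rewrite tpermC; exact: top.
Qed.

(** * The value of S(d,k) and the recursion *)

Lemma even_solvable_count_small (d k : nat) :
  0 < k -> k < d -> even_solvable d k (count_small d k).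
Proof.
move=> k0 kd; pose K := [set S : {set 'I_d} | k <= #|S|].
have cardK : 2 ^ d - count_small d k = #|K|.
  have := cardsC [set S : {set 'I_d} | #|S| < k]; rewrite card_small_sets.
  rewrite -cardsT -powersetT card_powerset cardsT card_ord => <-; rewrite addKn.
  by apply: eq_card => S; rewrite !inE -leqNgt.
pose h (t : token d (count_small d k)) : {set 'I_d} := enum_val (cast_ord cardK t).
have hI : injective h by move=> s t /enum_val_inj/cast_ord_inj.
pose C := mk_config hI; have Cpos : pos C =1 h by exact: pos_mk_config.
have Ck t : k <= #|pos C t| by rewrite Cpos; have := enum_valP (cast_ord cardK t); rewrite inE.
have occ (X : {set 'I_d}) : k <= #|X| -> exists t, pos C t = X.
  move=> kX; have XK : X \in K by rewrite inE.
  by exists (cast_ord (esym cardK) (enum_rank_in XK X)); rewrite Cpos /h cast_ordKV enum_rankK_in.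
have [|a0 Ca0] := occ setT; first by rewrite cardsT card_ord ltnW.
have i0 : 'I_d by exact: Ordinal kd.
have [|b0 Cb0] := occ [set~ i0]; first by rewrite cardsC1 card_ord; lia.
apply/existsP; exists C; apply/forallP => g; apply/implyP => ev.
have := even_perm_in_group (tperm_coset k0 Ck occ kd Ca0 Cb0) ev.
by rewrite inE.
Qed.

(** On the diagonal the conventional value agrees with the count. Off it, any smaller [l] leaves
    more than three tokens, so the lower bound applies. *)
Lemma solv_minE (d k : nat) : 0 < k -> k <= d -> solv_min d k = count_small d k.
Proof.
move=> k0 kd; rewrite /solv_min; case: eqVneq => [->|dk]; first by rewrite count_small_diag.
have ltkd : k < d by rewrite ltn_neqAle eq_sym dk.
case: ex_minnP => l /andP[/andP[l0 l2] ev] min_l; apply/eqP; rewrite eqn_leq.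
have small := count_small_tokens k0 ltkd.
have pos_small := count_small_gt0 d k0.
apply/andP; split.
  by apply: min_l; rewrite even_solvable_count_small // pos_small /=; lia.
rewrite leqNgt; apply: contraL ev => lt_l.
by apply: even_solvable_lower => //; lia.
Qed.

Theorem theorem4p4 (k n : nat) (hk : 2 <= k) (hn : 1 <= n) :
  [/\ solv_min (n + k) k = solv_min (n + k - 1) (k - 1) + solv_min (n + k - 1) k,
      forall C : config (n + k) (solv_min (n + k) k - 1),
        semi_isolated k C \/ isolated k C &
      even_solvable (n + k) k (solv_min (n + k) k)].
Proof.
have lt_kd : k < n + k by lia.
have small := count_small_tokens (ltnW hk) lt_kd.
(* [2 <= k] makes [k - 1] positive; for [n = 1] the last term is the diagonal value. *)
rewrite !solv_minE; try lia.
split; last by apply: even_solvable_count_small; lia.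
  case: k hk {lt_kd small} => // k hk; rewrite addnS !subSS !subn0.
  exact: count_smallSS.
have pos_small := count_small_gt0 (n + k) (ltnW hk).
by move=> C; apply: semi_isolated_or_isolated; lia.
Qed.
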